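(* Let $\mathbf{I} = (X,f,x_0)$ be a minimal iterator with $\omega$ the assignment of finite sets in $\mathbf{I}$. There exists a unique binary operation $\oplus$ on $X$ such that $$\omega(A) \oplus \omega(B) = \omega(A \cup B)$$ whenever $A$ and $B$ are disjoint finite sets. This operation $\oplus$ is both associative and commutative, $x \oplus x_0 = x$ for all $x \in X$, and for all $x_1, x_2 \in X$ there is an $x \in X$ such that either $x_1 = x_2 \oplus x$ or $x_2 = x_1 \oplus x$. Moreover, $\oplus$ is the unique binary operation on $X$ such that (a0) $x \oplus x_0 = x$ for all $x \in X$; (a1) $x \oplus f(x') = f(x \oplus x')$ for all $x, x' \in X$.
   Context: A set $E$ is finite if $\mathcal{P}(E)$ is the only subset $\mathcal{S}$ of the power set $\mathcal{P}(E)$ such that $\varnothing \in \mathcal{S}$ and $F \cup \{e\} \in \mathcal{S}$ whenever $F \in \mathcal{S}$, $F \neq E$ and $e \in E \setminus F$ (this is equivalent to the usual notion of finiteness). $\mathsf{Fin}$ denotes the (proper) class of all finite sets. An iterator is a triple $\mathbf{I} = (X,f,x_0)$ with $X$ a class (a set or a proper class), $f : X \to X$ a mapping and $x_0$ an element of $X$. The assignment of finite sets in $\mathbf{I}$ is the unique mapping $\omega : \mathsf{Fin} \to X$ with $\omega(\varnothing) = x_0$ and $\omega(A \cup \{a\}) = f(\omega(A))$ for each finite set $A$ and each element $a \notin A$. A subclass $Y$ of $X$ is $f$-invariant if $f(y) \in Y$ for all $y \in Y$. $\mathbf{I}$ is minimal if the only $f$-invariant subclass of $X$ containing $x_0$ is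 $X$ itself. *)

(* Defs.v *)
From mathcomp Require Import all_boot finmap.
From mathcomp Require Import boolp classical_sets functions cardinality.

Set Implicit Arguments.
Unset Strict Implicit.
Unset Printing Implicit Defensive.

Local Open Scope classical_set_scope.

(* Sets are subsets [A : set T] of an arbitrary type [T]; since unions only
   make sense inside a common ambient type, the class of all finite sets is the
   family [Fin T], indexed by every type [T]. *)

Definition Pow (T : Type) (E : set T) : set (set T) := [set F | F `<=` E].

Definition inductive_family (T : Type) (E : set T) (S : set (set T)) : Prop :=
  [/\ S `<=` Pow E,
      S set0 &
      forall (F : set T) (e : T),
        S F -> F <> E -> (E `\` F) e -> S (F `|` [set e])].

(* [unique P x] is [P x /\ forall y, P y -> x = y]. *)
Definition finite (T : Type) (E : set T) : Prop :=
  unique (inductive_family E) (Pow E).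

Record Fin (T : Type) : Type :=
  MkFin { fin_set :> set T; fin_finite : finite fin_set }.

Lemma Pow_inductive (T : Type) (E : set T) : inductive_family E (Pow E).
Proof.
split; [by [] | by move=> x [] |].
by move=> F e FE _ [Ee _] x [/FE //|->].
Qed.

Lemma finiteP (T : Type) (E : set T) :
  finite E <->
  forall S : set (set T), S set0 ->
    (forall F e, S F -> F `<=` E -> E e -> ~ F e -> S (F `|` [set e])) ->
    Pow E `<=` S.
Proof.
split=> [[_ fE] S S0 SU|fE].
  have -> : Pow E = S `&` Pow E.
    apply: fE; split=> [F []//| |F e [SF FE] _ [Ee nFe]].
      by split=> //; exact: sub0set.
    by split; [exact: SU | move=> x [/FE //|->]].
  by move=> F [].
split; [exact: Pow_inductive | move=> S [SE S0 SU]].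
apply/seteqP; split=> //; apply: fE => // F e SF FE Ee nFe.
by apply: SU => // FeqE; apply: nFe; rewrite FeqE.
Qed.

Lemma finite0 (T : Type) : finite (@set0 T).
Proof. by apply/finiteP => S S0 _ F; rewrite /Pow/= subset0 => ->. Qed.

Lemma finiteU1 (T : Type) (E : set T) (a : T) :
  finite E -> finite (E `|` [set a]).
Proof.
move=> /finiteP fE; apply/finiteP => S S0 SU.
have ES : Pow E `<=` S.
  apply: fE => // F e SF FE Ee nFe.
  by apply: SU => // [x /FE|]; left.
move=> G GEa; have GE : G `\ a `<=` E.
  by move=> x [/GEa [//|xa] nxa]; case: nxa.
have [Ga|nGa] := pselect (G a); last first.
  by apply: ES => x Gx; case: (GEa x Gx) => // xa; case: nGa; rewrite -xa.
have -> : G = G `\ a `|` [set a].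
  apply/seteqP; split=> [x Gx|x [[]//|->//]].
  by have [->|xa] := pselect (x = a); [right|left].
apply: SU; [exact: ES|by move=> x /GE; left|by right|by case=> _; apply].
Qed.

Lemma finiteU (T : Type) (A B : set T) :
  finite A -> finite B -> finite (A `|` B).
Proof.
move=> fA /finiteP fB; apply: (fB [set F | finite (A `|` F)]) => //=.
  by rewrite setU0.
by move=> F e fAF _ _ _; rewrite setUA; exact: finiteU1.
Qed.

Definition fin0 (T : Type) : Fin T := MkFin (@finite0 T).

Definition finU1 (T : Type) (A : Fin T) (a : T) : Fin T :=
  MkFin (finiteU1 a (fin_finite A)).

Definition finU (T : Type) (A B : Fin T) : Fin T :=
  MkFin (finiteU (fin_finite A) (fin_finite B)).

Record iterator : Type :=
  Iterator { carrier :> Type; step : carrier -> carrier; base : carrier }.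

Definition invariant_under (X : Type) (f : X -> X) (Y : set X) : Prop :=
  forall y, Y y -> Y (f y).

Definition minimal (I : iterator) : Prop :=
  forall Y : set I, invariant_under (@step I) Y -> Y (base I) -> Y = setT.

Definition assignment (I : iterator) (w : forall T : Type, Fin T -> I) : Prop :=
  (forall T : Type, w T (fin0 T) = base I) /\
  (forall (T : Type) (A : Fin T) (a : T),
     ~ fin_set A a -> w T (finU1 A a) = step (w T A)).

Lemma exists_unique_assignment (I : iterator) :
  exists! w : forall T : Type, Fin T -> I, assignment w.
Proof.
have fin_finite_set T (A : Fin T) : finite_set A.
  case: A => A /= /finiteP fA; apply: (fA finite_set) => //.
  by move=> F e fF _ _ _; rewrite finite_setU; split.
exists (fun T (A : Fin T) =>
  iter #|` fset_set (fin_set A : set {classic T})| (@step I) (base I)).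
split=> [|w [w0 wS]].
  split=> [T|T A a nAa] /=; first by rewrite fset_set0 cardfs0.
  have fA : finite_set (fin_set A : set {classic T}) := fin_finite_set T A.
  rewrite fset_setU//= fset_set1 fsetUC cardfsU1.
  have -> // : (a : {classic T}) \notin fset_set (fin_set A : set {classic T}).
  by apply/negP; rewrite in_fset_set// inE.
apply: functional_extensionality_dep => T; apply/funext => A.
pose g F := iter #|` fset_set (F : set {classic T})| (@step I) (base I).
suff H : fin_set A `<=` A -> forall h : finite A, g A = w T (MkFin h).
  by case: A H => A hA /= H; exact: H.
have /finiteP fA := fin_finite A.
move: (fA [set F | forall h : finite F, g F = w T (MkFin h)]) => H AA.
apply: H => //=.
  move=> h; rewrite /g fset_set0 cardfs0 /= -(w0 T).
  by rewrite /fin0; congr (w T (MkFin _)); exact: Prop_irrelevance.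
move=> F e IH FA Ae nFe h.
have hF : finite F.
  apply/finiteP => S S0 SU G GF; apply: (fA (fun K => K `<=` F -> S K)) => //.
    move=> K x SK _ _ nKx KxF; apply: SU => //; last by apply: KxF; right.
      by apply: SK => y Ky; apply: KxF; left.
    by move=> y Ky; apply: KxF; left.
  by move=> x /GF /FA.
have fF : finite_set (F : set {classic T}) := fin_finite_set T (MkFin hF).
have -> : g (F `|` [set e]) = step (g F).
  rewrite /g fset_setU//= fset_set1 fsetUC cardfsU1.
  have -> // : (e : {classic T}) \notin fset_set (F : set {classic T}).
  by apply/negP; rewrite in_fset_set// inE.
rewrite (IH hF) -(wS T (MkFin hF) e nFe) /finU1.
by congr (w T (MkFin _)); exact: Prop_irrelevance.
Qed.

Definition union_compatible (I : iterator) (w : forall T : Type, Fin T -> I)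
    (op : I -> I -> I) : Prop :=
  forall (T : Type) (A B : Fin T),
    A `&` B = set0 -> op (w T A) (w T B) = w T (finU A B).

Definition addition_law_a0 (I : iterator) (op : I -> I -> I) : Prop :=
  forall x : I, op x (base I) = x.

Definition addition_law_a1 (I : iterator) (op : I -> I -> I) : Prop :=
  forall x x' : I, op x (step x') = step (op x x').

(* Main.v *)
Require Import Defs.
From mathcomp Require Import all_boot.
From mathcomp Require Import boolp classical_sets.

(** Minimality says that every element of [I] is an iterate [f^n x0] of the
    base point, so an operation on [I] is determined by its values on pairs of
    iterates.  Two facts drive the proof.

    First, the operations satisfying (a0) and (a1) and the union compatible ones
    are all forced to be [f^m x0 + f^n x0 = f^(m + n) x0].  Indeed (a0) and (a1)
    give union compatibility by induction on the finite set [B]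
    ([recursion_union_compatible]), and union compatibility, tested on the
    disjoint integer intervals [0, m) and [m, m + n), gives the formula
    ([union_compatible_iter]).  This yields both uniqueness claims at once.

    Secondly, such an operation exists: put [x + y = f^n x] for any [n] with
    [y = f^n x0].  The choice of [n] is immaterial, since the iterates of [f]
    commute and [x] is itself an iterate of [x0], so that [f^n x] is determined
    by [f^n x0] ([iter_base_eq]).

    Associativity, commutativity and the comparability of any two elements are
    then those of the addition of natural numbers. *)

Local Open Scope classical_set_scope.

Lemma fin_set_inj (T : Type) (A B : Fin T) : fin_set A = fin_set B -> A = B.
Proof.
case: A B => [A fA] [B fB] /= AB; case: B / AB fB => fB.
by congr MkFin; exact: Prop_irrelevance.
Qed.

(** The induction principle contained in the definition of finiteness.  The
    family it is applied to records the finiteness of its members, which the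
    property [P] needs. *)
Lemma Fin_induction (T : Type) (P : Fin T -> Prop) :
  P (fin0 T) ->
  (forall (A : Fin T) (a : T), ~ fin_set A a -> P A -> P (finU1 A a)) ->
  forall A : Fin T, P A.
Proof.
move=> P0 PU A; have /finiteP fA := fin_finite A.
have [||hA PA] := fA [set F | exists hF : finite F, P (MkFin hF)] _ _ A (fun=> id).
- by exists (@finite0 T).
- move=> F e [hF PF] _ _ nFe.
  by exists (finiteU1 e hF); exact: (PU (MkFin hF)).
- by rewrite (_ : A = MkFin hA)//; exact: fin_set_inj.
Qed.

Fixpoint interval (m n : nat) : Fin nat :=
  if n is n'.+1 then finU1 (interval m n') (m + n') else fin0 nat.

Lemma intervalE (m n k : nat) : fin_set (interval m n) k <-> m <= k < m + n.
Proof.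
elim: n => [|n IH] /=.
  by rewrite addn0; split=> // /andP[/leq_ltn_trans h /h]; rewrite ltnn.
rewrite addnS ltnS (leq_eqVlt k); split=> [[/IH/andP[-> ->]|->]|].
- by rewrite orbT.
- by rewrite leq_addr eqxx.
- move=> /andP[mk /predU1P[->|kmn]]; first by right.
  by left; apply/IH; rewrite mk.
Qed.

Section Iterates.
Variable I : iterator.
Local Notation f := (@step I).
Local Notation x0 := (base I).

Lemma minimal_iter (hI : minimal I) (x : I) : exists n, x = iter n f x0.
Proof.
have iterT : [set y | exists n, y = iter n f x0] = setT.
  by apply: hI => [y [n ->]|]; [exists n.+1 | exists 0].
by have : [set: I] x by []; rewrite -iterT.
Qed.

(** If [x = f^k x0] then [f^n x = f^k (f^n x0)], which depends on [n] only
    through [f^n x0]. *)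
Lemma iter_base_eq (hI : minimal I) (m n : nat) (x : I) :
  iter m f x0 = iter n f x0 -> iter m f x = iter n f x.
Proof.
have [k ->] := minimal_iter hI x.
by move=> mn; rewrite -!iterD addnC iterD mn -iterD addnC.
Qed.

Lemma exists_recursion (hI : minimal I) :
  exists op : I -> I -> I, addition_law_a0 op /\ addition_law_a1 op.
Proof.
have [rank rankE] := choice (minimal_iter hI).
exists (fun x y => iter (rank y) f x); split=> [x|x y].
  by rewrite (iter_base_eq hI _ 0)// -rankE.
by rewrite -iterS; apply: (iter_base_eq hI); rewrite iterS -!rankE.
Qed.

Variable w : forall T : Type, Fin T -> I.
Hypothesis hw : assignment w.

Lemma assignment_interval (m n : nat) : w nat (interval m n) = iter n f x0.
Proof.
case: hw => w0 wS; elim: n => [|n IH] /=; first exact: w0.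
by rewrite wS ?IH// intervalE ltnn andbF.
Qed.

(** Adding to [B] a point outside [A] and [B] applies [f] to both sides of
    [op (w A) (w B) = w (A `|` B)], by (a1) on the left. *)
Lemma recursion_union_compatible (op : I -> I -> I) :
  addition_law_a0 op -> addition_law_a1 op -> union_compatible w op.
Proof.
case: hw => w0 wS a0 a1 T A; apply: Fin_induction => [_|B b nBb IH AB].
  by rewrite w0 a0; congr w; apply: fin_set_inj; rewrite /= setU0.
have nAb : ~ fin_set A b.
  by move=> Ab; suff: @set0 T b by []; rewrite -AB; split=> //; right.
have AB0 : fin_set A `&` fin_set B = set0.
  by rewrite -subset0 -AB => x [Ax Bx]; split=> //; left.
rewrite wS// a1 IH// -(wS _ _ b); last by case.
by congr w; apply: fin_set_inj; rewrite /= setUA.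
Qed.

(** The intervals [0, m) and [m, m + n) are disjoint, have values [f^m x0] and
    [f^n x0], and their union is [0, m + n). *)
Lemma union_compatible_iter (op : I -> I -> I) : union_compatible w op ->
  forall m n, op (iter m f x0) (iter n f x0) = iter (m + n) f x0.
Proof.
move=> opU m n.
rewrite -(assignment_interval 0 m) -(assignment_interval m n) opU.
  rewrite -(assignment_interval 0 (m + n)); congr w; apply: fin_set_inj.
  apply/seteqP; split=> k /=; rewrite !intervalE !add0n /=.
    by case=> [/ltn_addr->|/andP[]].
  by case: (ltnP k m) => [|_] ?; [left|right].
rewrite -subset0 => k [/intervalE + /intervalE/andP[mk _]].
by rewrite add0n ltnNge mk.
Qed.

Lemma union_compatible_unique (hI : minimal I) (p q : I -> I -> I) :
  union_compatible w p -> union_compatible w q -> p = q.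
Proof.
move=> /union_compatible_iter pE /union_compatible_iter qE.
apply/funext => x; apply/funext => y.
have [[m ->] [n ->]] := (minimal_iter hI x, minimal_iter hI y).
by rewrite pE qE.
Qed.

End Iterates.

Theorem theorem10p1 (I : iterator) (w : forall T : Type, Fin T -> I)
    (hI : minimal I) (hw : assignment w) :
  exists op : I -> I -> I,
    unique (union_compatible w) op /\
    associative op /\
    commutative op /\
    (forall x : I, op x (base I) = x) /\
    (forall x1 x2 : I, exists x : I, x1 = op x2 x \/ x2 = op x1 x) /\
    unique (fun p : I -> I -> I => addition_law_a0 p /\ addition_law_a1 p) op.
Proof.
have [op [a0 a1]] := exists_recursion I hI.
have opU := recursion_union_compatible I w hw op a0 a1.
have opE := union_compatible_iter I w hw op opU.
have iterE := minimal_iter I hI.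
exists op; split; [|split; [|split; [|split; [exact: a0|split]]]].
- by split=> // q; exact: union_compatible_unique.
- move=> x y z.
  have [[k ->] [[m ->] [n ->]]] := (iterE x, (iterE y, iterE z)).
  by rewrite !opE addnA.
- move=> x y; have [[m ->] [n ->]] := (iterE x, iterE y).
  by rewrite !opE addnC.
- move=> x y; have [[m ->] [n ->]] := (iterE x, iterE y).
  have [nm|mn] := leqP n m.
    by exists (iter (m - n) (@step I) (base I)); left; rewrite opE subnKC.
  by exists (iter (n - m) (@step I) (base I)); right; rewrite opE subnKC// ltnW.
- split=> // q [q0 q1]; apply: (union_compatible_unique I w hw hI) => //.
  exact: recursion_union_compatible.
Qed.
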